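(* The function $n \mapsto \beta(n) = \min_{\pi\in \Pi(n)} \mathbb{E}[\tau_n]$, $n = 1,2,\ldots$, is convex (i.e. $n\mapsto \beta(n+1)-\beta(n)$ is nondecreasing), $\beta(1)=1$, and for all $n \geq 2$ one has the bounds $$\frac{1}{2} n^2 \leq \beta(n) \leq \frac{1}{2} n^2 + n \log n .$$
   Context: Let $X_1, X_2, \ldots$ be independent real random variables with a common continuous distribution function $F$, and let $\mathcal{F}_i=\sigma\{X_1,\ldots,X_i\}$ for $i\ge 1$ ($\mathcal F_0$ trivial). For an integer $n\ge 1$, a selection policy is a sequence $\pi=(\tau_1,\ldots,\tau_n)$ of stopping times with respect to the filtration $(\mathcal{F}_i)$ such that, almost surely, $1\leq \tau_1<\tau_2<\cdots<\tau_n<\infty$ and $X_{\tau_1}<X_{\tau_2}<\cdots<X_{\tau_n}$. $\Pi(n)$ denotes the set of all selection policies with $\mathbb{E}[\tau_n]<\infty$, and $\beta(n)=\min_{\pi\in\Pi(n)}\mathbb{E}[\tau_n]$. $\log$ is the natural logarithm. *)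

(* Defs.v *)
From HB Require Import structures.
From mathcomp Require Import all_boot all_order all_algebra finmap.
From mathcomp Require Import all_classical all_reals all_analysis.

Set Implicit Arguments.
Unset Strict Implicit.
Unset Printing Implicit Defensive.

Import Order.TTheory GRing.Theory Num.Theory.
Import numFieldNormedType.Exports.

Local Open Scope classical_set_scope.
Local Open Scope ring_scope.

(* The sequence X_1, X_2, ... is indexed from 0: [X i] stands for X_(i+1). *)

Definition independent_seq (d : measure_display) (T : measurableType d)
    (R : realType) (P : probability T R) (X : nat -> {RV P >-> R}) : Prop :=
  forall (J : {fset nat}) (B : nat -> set R), (forall i, measurable (B i)) ->
    P (\bigcap_(i in [set` J]) (X i @^-1` B i)) =
    (\prod_(i <- J) P (X i @^-1` B i))%E.

(* sigma(X_1, ..., X_i); for i = 0 this is {set0, setT}. *)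
Definition natural_filtration (d : measure_display) (T : measurableType d)
    (R : realType) (P : probability T R) (X : nat -> {RV P >-> R}) (i : nat) :
    set (set T) :=
  g_sigma_preimage (fun j : 'I_i => X j : T -> R).

(* Random times take values in nat together with infinity, encoded as [None]. *)
Definition time_le (t : option nat) (i : nat) : bool :=
  if t is Some m then (m <= i)%N else false.

Definition time_ereal (R : realType) (t : option nat) : \bar R :=
  if t is Some m then (m%:R)%:E else +oo%E.

Definition stopping_time (T : Type) (G : nat -> set (set T))
    (tau : T -> option nat) : Prop :=
  forall i : nat, G i [set w | time_le (tau w) i].

(* [tnth pi k] is tau_(k+1), and [X (t k).-1] is X_(t k). *)
Definition selection_policy (d : measure_display) (T : measurableType d)
    (R : realType) (P : probability T R) (X : nat -> {RV P >-> R}) (n : nat)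
    (pi : n.-tuple (T -> option nat)) : Prop :=
  (forall k : 'I_n, stopping_time (natural_filtration X) (tnth pi k)) /\
  {ae P, forall w, exists t : 'I_n -> nat,
    [/\ forall k, tnth pi k w = Some (t k),
        forall k, (1 <= t k)%N,
        forall j k : 'I_n, (j < k)%N -> (t j < t k)%N
      & forall j k : 'I_n, (j < k)%N -> X (t j).-1 w < X (t k).-1 w]}.

(* E[tau_n]; the default value of [last] is only reached when n = 0. *)
Definition expected_last_time (d : measure_display) (T : measurableType d)
    (R : realType) (P : probability T R) (n : nat)
    (pi : n.-tuple (T -> option nat)) : \bar R :=
  (\int[P]_w time_ereal R (last (fun=> None) pi w))%E.

Definition Pi_ (d : measure_display) (T : measurableType d)
    (R : realType) (P : probability T R) (X : nat -> {RV P >-> R}) (n : nat) :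
    set (n.-tuple (T -> option nat)) :=
  [set pi | selection_policy X pi /\ (expected_last_time P pi < +oo)%E].
Arguments Pi_ {d T R P} X n.

Definition beta (d : measure_display) (T : measurableType d)
    (R : realType) (P : probability T R) (X : nat -> {RV P >-> R}) (n : nat) :
    \bar R :=
  ereal_inf [set expected_last_time P pi | pi in Pi_ X n].

(* Main.v *)
Require Import Defs.
From HB Require Import structures.
From mathcomp Require Import all_boot all_order all_algebra finmap.
From mathcomp Require Import all_classical all_reals all_analysis.
From mathcomp Require Import measurable_realfun ring lra zify.

Set Implicit Arguments.
Unset Strict Implicit.
Unset Printing Implicit Defensive.

Import Order.TTheory GRing.Theory Num.Theory.
Import numFieldNormedType.Exports.

Local Open Scope classical_set_scope.
Local Open Scope ring_scope.

(** The observations matter only through their ranks F (X_i), which are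
    independent and uniform on [0, 1]. Suppose that k selections remain above
    a level x. The ranks above x are again uniform and are met at rate 1 - x,
    so the optimal remaining time should be v_k / (1 - x) for a sequence v.
    Accepting the next rank in a window of relative width t above the level
    gives v_(k+1) = min_t (1 - v_k ln (1 - t)) / t. At the minimum
    1 - t = v_k / v_(k+1), and so v_(k+1) - v_k - v_k ln (v_(k+1) / v_k) = 1:
    this equation defines [value], and the theorem follows from
    beta n = value n ([beta_value]).

    The analytic claims only use that v_(k+1) is a minimum over t
    ([value_le_threshold], with equality in [width_eq]). Convexity:
    v_(k+1) - v_k = min_t (1 / t + v_k (- ln (1 - t) / t - 1)) is nondecreasing
    in v_k. Lower bound: - ln (1 - t) >= 2 t / (2 - t) and AM-GM. Upper bound:
    the competitor t with t / (1 - t) = 2 / (n + ln n).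

    To identify beta, follow the potential v_k / (1 - x) along the run of a
    policy. Elapsed time plus potential has constant mean under the policy that
    always uses the optimal window; as the potential is nonnegative, that policy
    needs mean time at most v_n ([threshold_policy_cost_le]). For an arbitrary
    policy, elapsed time plus potential should be a submartingale, and the
    potential left at time i should vanish in the mean as i grows. The second
    point requires a bounded potential. Truncating v_k / (1 - x) at a constant
    preserves the submartingale inequality ([potential_le_best]): it amounts to
    moving the level x down. Then the potential left at time i is at most a
    constant times the probability that the policy is unfinished, and every
    policy needs mean time at least v_n ([policy_cost_ge]).

    Averaging over a new observation given the past is done through the product
    law of an adapted variable and a new observation ([integral_fresh]). *)

(** * Two bounds on the logarithm *)

Section log_bounds.
Variable R : realType.
Implicit Types x y : R.

Lemma ln_le_sub1 x : 0 < x -> ln x <= x - 1.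
Proof.
move=> x0; have := @le_ln1Dx R (x - 1).
by rewrite (_ : 1 + (x - 1) = x); [apply; lra | lra].
Qed.

(** Both bounds below are equalities at 1 and are propagated to the right by
    the sign of a derivative. *)
Lemma ge0_from1_derive (f g : R -> R) :
  (forall x, 0 < x -> is_derive x 1 f (g x)) ->
  (forall x, 1 < x -> 0 <= g x) -> f 1 = 0 ->
  forall x, 1 <= x -> 0 <= f x.
Proof.
move=> df g0 f1 x x1; rewrite -f1.
apply: (@ger0_derive1_ndecr R f 1 x) => //.
- move=> y; rewrite in_itv/= => /andP[y1 _].
  by have [] := df y (lt_trans ltr01 y1).
- move=> y; rewrite in_itv/= => /andP[y1 _].
  rewrite derive1E; have /@derive_val -> := df y (lt_trans ltr01 y1).
  exact: g0.
- apply: derivable_within_continuous => y; rewrite in_itv/= => /andP[y1 _].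
  by have [] := df y (lt_le_trans ltr01 y1).
Qed.

(** With x = 1 / (1 - t) this reads 2 t / (2 - t) <= - ln (1 - t), the form in
    which AM-GM gives exactly n ^ 2 / 2 in [value_ge_half_sq]. *)
Lemma ln_ge_pade x : 1 <= x -> 2 * (x - 1) / (x + 1) <= ln x.
Proof.
move=> x1; rewrite -subr_ge0.
pose f y : R := ln y - 2 * (y - 1) * (y + 1)^-1.
apply: (@ge0_from1_derive f (fun y => y^-1 - 4 * (y + 1)^-1 ^+ 2)) => //.
- move=> y y0; rewrite /f.
  have y1 : y + 1 != 0 by rewrite gt_eqF// addr_gt0.
  have dl := is_derive1_ln y0.
  apply: is_derive_eq.
  by rewrite /GRing.scale /=; field; rewrite y1 gt_eqF.
- move=> y y1; rewrite (_ : _ - _ = (y - 1) ^+ 2 * (y^-1 * (y + 1)^-1 ^+2)).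
    by rewrite mulr_ge0 ?sqr_ge0 // mulr_ge0 ?sqr_ge0// invr_ge0; lra.
  by field; rewrite ?gt_eqF//; lra.
- by rewrite /f ln1 subrr mulr0 mul0r subrr.
Qed.

(** With x = 1 + s this reads (1 + s) ln (1 + s) <= s + s ^ 2 / 2, which makes
    [value_le_threshold] explicit in [value_step]. *)
Lemma ln_le_half_sub_inv x : 1 <= x -> ln x <= (x - x^-1) / 2.
Proof.
move=> x1; rewrite ler_pdivlMr// -subr_ge0.
pose f y : R := y - y^-1 - ln y * 2.
apply: (@ge0_from1_derive f (fun y => 1 + y^-1 ^+ 2 - 2 * y^-1)) => //.
- move=> y y0; rewrite /f.
  have y1 : y != 0 by rewrite gt_eqF.
  have dl := is_derive1_ln y0.
  have dv := @is_deriveV R id y 1 1 y1 (is_derive_id _ _).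
  apply: is_derive_eq.
  by rewrite /GRing.scale /=; field.
- move=> y y1; rewrite (_ : _ - _ = (1 - y^-1) ^+ 2); last by field; lra.
  by rewrite sqr_ge0.
- by rewrite /f ln1 invr1 subrr mul0r subrr.
Qed.

End log_bounds.

(** * The value sequence: recursion, convexity and growth *)

Section value.
Variable R : realType.

(** If the later selections cost b, accepting the next element in a window of
    relative width t costs (1 - b ln (1 - t)) / t in all. At the minimum y
    over t the derivative vanishes, which means 1 - t = b / y; substituting
    this value of t gives the equation below. For b = 0 it reads y = 1, thanks
    to ln 0 = 0. *)
Definition next_value (b : R) : R :=
  xget 0 [set y | b <= y /\ y - b - b * ln (y / b) = 1].

(** The left-hand side vanishes at y = b, and is at least 1 at y = 2 (b + 1)
    because ln (2 (b + 1) / b) = ln (1 + 1 / b) + ln 2 <= 1 / b + 1. *)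
Lemma next_valueP (b : R) : 0 <= b ->
  b <= next_value b /\ next_value b - b - b * ln (next_value b / b) = 1.
Proof.
move=> b0; rewrite /next_value; case: xgetP => [y _ //|nex]; exfalso.
move: b0; rewrite le_eqVlt => /predU1P[b0|b0].
  by apply: (nex 1); rewrite -b0 /= mul0r !subr0.
pose f y : R := y - b - b * ln (y / b).
pose Y := 2 * (b + 1).
have bY : b <= Y by rewrite /Y; lra.
have f1 : f b = 0 by rewrite /f divff ?gt_eqF// ln1; lra.
have fY : 1 <= f Y.
  have : ln (Y / b / 2) <= Y / b / 2 - 1.
    by apply: ln_le_sub1; rewrite !divr_gt0//; rewrite /Y; lra.
  have h2 : ln 2 <= 1 :> R by apply: le_trans (ln_le_sub1 _) _; lra.
  rewrite ln_div ?posrE ?divr_gt0 //; last by rewrite /Y; lra.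
  have -> : Y / b / 2 - 1 = b^-1 by rewrite /Y; field; rewrite gt_eqF.
  rewrite lerBlDr => h; have {}h := le_trans h (lerD (lexx _) h2).
  rewrite /f; have := ler_wpM2l (ltW b0) h.
  rewrite mulrDr divff ?gt_eqF// /Y; lra.
have cf : {within `[b, Y], continuous f}.
  apply: derivable_within_continuous => y; rewrite in_itv/= => /andP[yb _].
  have y0 : 0 < y / b by rewrite divr_gt0// (lt_le_trans b0).
  have dl := is_derive1_ln y0.
  have dd : is_derive y 1 (fun y : R => y / b) b^-1.
    by apply: is_derive_eq; rewrite /GRing.scale/=; ring.
  have dc : is_derive y 1 (fun y : R => ln (y / b)) ((y / b)^-1 * b^-1).
    exact: (@is_derive1_comp R (@ln R) (fun y : R => y / b)).
  by rewrite /f; apply: ex_derive.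
have [|y] := IVT bY cf (v := 1).
  by rewrite f1 ge_min ler01/= le_max fY orbT.
by rewrite in_itv/= => /andP[yb _] fy; apply: (nex y); split.
Qed.

Fixpoint value (n : nat) : R := if n is m.+1 then next_value (value m) else 0.

Lemma value_ge0 n : 0 <= value n.
Proof. by elim: n => //= n ih; have [+ _] := next_valueP ih; exact: le_trans. Qed.

Lemma value_le n : value n <= value n.+1.
Proof. by have [] := next_valueP (value_ge0 n). Qed.

Lemma valueS n :
  value n.+1 - value n - value n * ln (value n.+1 / value n) = 1.
Proof. by have [] := next_valueP (value_ge0 n). Qed.

Lemma value1 : value 1 = 1.
Proof. by have := valueS 0; rewrite /= mul0r !subr0. Qed.

Lemma value_lt n : value n < value n.+1.
Proof.
rewrite lt_neqAle value_le andbT; apply/eqP => e.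
have := valueS n; rewrite -e subrr sub0r.
have [->|v0] := eqVneq (value n) 0.
  by rewrite mul0r oppr0 => /esym/eqP; rewrite oner_eq0.
by rewrite divff// ln1 mulr0 oppr0 => /esym/eqP; rewrite oner_eq0.
Qed.

Lemma valueS_gt0 n : 0 < value n.+1.
Proof. exact: le_lt_trans (value_ge0 n) (value_lt n). Qed.

Lemma value_homo m n : (m <= n)%N -> value m <= value n.
Proof. by move=> mn; apply: (homo_leq (fun _ => lexx _) le_trans value_le). Qed.

(** Minimality of the next value over all widths t, by concavity of ln: the
    tangent bound ln z <= z - 1 is used at z = (1 - t) * value n.+1 / value n,
    which equals 1 exactly at the optimal t. *)
Lemma value_le_threshold n t : 0 < t < 1 ->
  value n.+1 * t <= 1 - value n * ln (1 - t).
Proof.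
case: n => [|n] /andP[t0 t1].
  by rewrite value1 /= mul0r subr0 mul1r ltW.
have v0 := valueS_gt0 n; have v1 := valueS_gt0 n.+1.
have vS := valueS n.+1; set c := value n.+1 in vS v0 *.
set y := value n.+2 in vS v1 *.
have yc : 0 < y / c by rewrite divr_gt0.
have t1' : 0 < 1 - t by lra.
have := ln_le_sub1 (mulr_gt0 t1' yc).
rewrite lnM ?posrE// => /(ler_wpM2l (ltW v0)).
have -> : c * ((1 - t) * (y / c) - 1) = (1 - t) * y - c by field; rewrite gt_eqF.
rewrite mulrDr; lra.
Qed.

(** The relative width of the optimal window when n selections remain: at its
    far end, selecting and passing cost the same. *)
Definition width n : R := 1 - value n.-1 / value n.

(** The optimal width attains equality in [value_le_threshold]; for n = 0 the
    width is 1 and the logarithmic term is 0 * ln 0. *)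
Lemma width_eq n : value n.+1 * width n.+1 = 1 - value n * ln (1 - width n.+1).
Proof.
rewrite /width subKr [_.+1.-1]/=.
have := valueS n; have := valueS_gt0 n; have := value_ge0 n.
rewrite le_eqVlt => /predU1P[<-|v0 v1 vS].
  by rewrite !mul0r !subr0 mulr1.
rewrite mulrBr mulr1 mulrCA divff ?gt_eqF// mulr1.
have -> : value n / value n.+1 = (value n.+1 / value n)^-1 by rewrite invf_div.
by rewrite lnV ?posrE ?divr_gt0//; lra.
Qed.

Lemma width_gt0 n : 0 < width n.+1.
Proof. by rewrite /width subr_gt0 ltr_pdivrMr ?valueS_gt0// mul1r value_lt. Qed.

Lemma width_lt1 n : width n.+2 < 1.
Proof. by rewrite /width ltrBlDr ltrDl divr_gt0 ?valueS_gt0. Qed.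

Lemma width_le1 n : width n.+1 <= 1.
Proof. by rewrite /width lerBlDr lerDl divr_ge0 ?value_ge0. Qed.

(** The increment value n.+1 - value n is the minimum over t of 1 / t + value
    n * (- ln (1 - t) / t - 1). The factor of value n is nonnegative, so the
    increment grows with value n. The width optimal for n.+1 serves as a
    competitor for n. *)
Lemma value_convex1 n :
  value n.+1 - value n <= value n.+2 - value n.+1.
Proof.
have w0 := width_gt0 n.+1; have w1 := width_lt1 n.
have := @value_le_threshold n (width n.+2); rewrite w0 w1 => /(_ isT).
have := width_eq n.+1; set t := width n.+2 in w0 w1 *.
have := @ln_le_sub1 R (1 - t); rewrite subr_gt0 => /(_ w1).
move=> /(ler_wpM2l (_ : 0 <= value n.+1 - value n)).
rewrite subr_ge0 value_le => /(_ isT) h1 h2 h3.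
rewrite -(ler_pM2r w0); lra.
Qed.

Lemma value_convex m n : (m <= n)%N ->
  value m.+1 - value m <= value n.+1 - value n.
Proof.
move=> mn; apply: (homo_leq (f := fun n => value n.+1 - value n)
  (fun _ => lexx _) le_trans value_convex1 mn).
Qed.

(** Induction: value n.+1 is (1 - value n * ln (1 - t)) / t at the optimal t.
    If value n >= n ^ 2 / 2, [ln_ge_pade] bounds this below, with y = 2 / t -
    1, by n ^ 2 / 2 + 1 / 2 + (y + n ^ 2 / y) / 2, and y + n ^ 2 / y >= 2 n. *)
Lemma value_ge_half_sq n : 2^-1 * n%:R ^+ 2 <= value n.
Proof.
elim: n => [|[_|n ih]]; first by rewrite expr0n mulr0.
  by rewrite value1 expr1n; lra.
have w0 := width_gt0 n.+1; have w1 := width_lt1 n.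
have := width_eq n.+1; set t := width n.+2 in w0 w1 * => e.
have t1' : 0 < 1 - t by lra.
have := @ln_ge_pade R (1 - t)^-1; rewrite invf_ge1// lnV ?posrE// => h.
have {}h : 2 * t / (2 - t) <= - ln (1 - t).
  apply: le_trans (h _); last by lra.
  by rewrite le_eqVlt; apply/orP; left; apply/eqP; field; lra.
rewrite -(ler_pM2r w0) e.
set N : R := n.+1%:R in ih *.
have -> : n.+2%:R = N + 1 :> R by rewrite -[in LHS]addn1 natrD.
have h0 : 0 <= 2 * t / (2 - t) by rewrite divr_ge0//; lra.
have h2 : 2^-1 * N ^+ 2 * (2 * t / (2 - t)) <= value n.+1 * (- ln (1 - t)).
  by rewrite ler_pM// mulr_ge0 ?invr_ge0 ?sqr_ge0.
suff : 0 <= 1 + 2^-1 * N ^+ 2 * (2 * t / (2 - t)) - 2^-1 * (N + 1) ^+ 2 * t.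
  by move: h2; rewrite mulrN; lra.
(* The case of equality in AM-GM is the vanishing of this square. *)
have -> : 1 + 2^-1 * N ^+ 2 * (2 * t / (2 - t)) - 2^-1 * (N + 1) ^+ 2 * t
   = (2 - t * (N + 1)) ^+ 2 / (2 * (2 - t)).
  by field; lra.
by rewrite divr_ge0 ?sqr_ge0//; lra.
Qed.

(** The competitor t = s / (1 + s), for which 1 - t = 1 / (1 + s). *)
Lemma value_step n s : 0 < s ->
  value n.+1 <= value n + 1 + s^-1 + value n * s / 2.
Proof.
move=> s0; have := @value_le_threshold n (s / (1 + s)).
have s1 : 0 < 1 + s by lra.
rewrite divr_gt0// ltr_pdivrMr// mul1r ltrDr ltr01 => /(_ isT).
have -> : 1 - s / (1 + s) = (1 + s)^-1 by field; lra.
rewrite lnV ?posrE// mulrN opprK mulrA ler_pdivrMr//.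
rewrite -ler_pdivlMr// => h; apply: (le_trans h).
rewrite ler_pdivrMr//.
have := @ln_le_half_sub_inv R (1 + s); rewrite lerDl => /(_ (ltW s0)).
move=> /(ler_wpM2l (value_ge0 n)) => h1.
apply: (@le_trans _ _ ((1 + value n * ((1 + s - (1 + s)^-1) / 2)) * (1 + s))).
  by apply: ler_wpM2r; [lra|rewrite lerD2l].
by rewrite le_eqVlt; apply/orP; left; apply/eqP; field; lra.
Qed.

(** Take s = 2 / (n + ln n) in [value_step], a proxy for the best choice sqrt
    (2 / value n). As value n <= (n + ln n) ^ 2 / 2, the increment is at most
    1 + n + ln n, and (n + 1) (ln (n + 1) - ln n) >= 1 leaves room. The base
    case n = 2 needs a sharper competitor, t = 2 / 3; it comes down to ln (27
    / 16) <= 1. *)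
Lemma value_le_sq_ln n : (2 <= n)%N ->
  value n <= 2^-1 * n%:R ^+ 2 + n%:R * ln n%:R.
Proof.
case: n => [//|[//|n _]]; elim: n => [|n ih].
  have := @value_le_threshold 1 (2 / 3); rewrite value1.
  have -> : (0 < 2 / 3 :> R) && (2 / 3 < 1 :> R) by apply/andP; split; lra.
  move=> /(_ isT); have -> : 1 - 2 / 3 = 3^-1 :> R by field.
  rewrite lnV ?posrE// mul1r opprK => h.
  have := @ln_le_sub1 R (3 ^+ 3 / 2 ^+ 4).
  rewrite ln_div ?posrE ?exprn_gt0// !lnXn// divr_gt0 ?exprn_gt0// => /(_ isT).
  rewrite -[ln 3 *+ _]mulr_natr -[ln 2 *+ _]mulr_natr; lra.
set N : R := n.+2%:R in ih *; set l := ln N in ih *.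
have N2 : 2 <= N by rewrite /N ler_nat.
have l0 : 0 <= l by rewrite /l ln_ge0//; lra.
have -> : n.+3%:R = N + 1 :> R by rewrite -[in LHS]addn1 natrD.
have s0 : 0 < 2 / (N + l) by rewrite divr_gt0//; lra.
apply: (le_trans (value_step n.+2 s0)).
have e1 : (2 / (N + l))^-1 = (N + l) / 2 by rewrite invf_div.
rewrite e1.
set v := value n.+2 in ih *.
have hv : v * (2 / (N + l)) / 2 <= (N + l) / 2.
  have -> : v * (2 / (N + l)) / 2 = v / (N + l) by field; lra.
  rewrite ler_pdivrMr; last lra.
  apply: (le_trans ih); rewrite -subr_ge0.
  rewrite (_ : _ - _ = l ^+ 2 / 2); last by field.
  by rewrite divr_ge0// sqr_ge0.
have hl : 1 <= (N + 1) * (ln (N + 1) - l).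
  have := @ln_le_sub1 R (N / (N + 1)); rewrite divr_gt0; try lra.
  rewrite ln_div ?posrE; try lra.
  have N1 : 0 < N + 1 by lra.
  move=> /(_ isT)/(ler_wpM2l (ltW N1)).
  have -> : (N + 1) * (N / (N + 1) - 1) = - 1 by field; lra.
  by rewrite -/l; lra.
move: ih hv hl; lra.
Qed.

End value.

(** * The ranks of the observations are uniform *)

Section uniformization.
Context (d : measure_display) (T : measurableType d) (R : realType)
  (P : probability T R) (X : nat -> {RV P >-> R}) (F : R -> R).
Hypothesis hF : continuous F.
Hypothesis hXF : forall (i : nat) (r : R), cdf (X i) r = (F r)%:E.

Lemma F_ge0 x : 0 <= F x.
Proof. by rewrite -lee_fin -(hXF 0); exact: cdf_ge0. Qed.

Lemma F_le1 x : F x <= 1.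
Proof. by rewrite -lee_fin -(hXF 0); exact: cdf_le1. Qed.

Lemma F_homo x y : x <= y -> F x <= F y.
Proof. by move=> xy; rewrite -lee_fin -!(hXF 0); exact: cdf_nondecreasing. Qed.

Lemma F_lt x y : F x < F y -> x < y.
Proof. by apply: contraTT; rewrite -!leNgt => /F_homo. Qed.

Lemma F_surj01 r : 0 < r < 1 -> exists x, F x = r.
Proof.
move=> /andP[r0 r1].
have FE : F = fine \o cdf (X 0) by apply/funext => x /=; rewrite hXF.
have Foo : F x @[x --> +oo] --> (1 : R).
  by rewrite FE; apply: fine_cvg; exact: cvg_cdfy1.
have FNoo : F x @[x --> -oo] --> (0 : R).
  by rewrite FE; apply: fine_cvg; exact: cvg_cdfNy0.
have [b rb] : exists b, r < F b.
  have : \forall x \near +oo, r < F x by apply: cvgr_gt Foo _ r1.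
  by move=> /filter_ex.
have [a ra] : exists a, F a < r.
  have : \forall x \near -oo, F x < r by apply: cvgr_lt FNoo _ r0.
  by move=> /filter_ex.
have ab : a <= b by rewrite ltW// F_lt// (lt_trans ra).
have [| |c _ <-] := @IVT R F a b r ab; last by exists c.
  exact: continuous_subspaceT.
by rewrite ge_min (ltW ra)/= le_max (ltW rb) orbT.
Qed.

(** The rank of observation i. A strict increase of ranks forces one of the
    observations, and an increase of the observations forces a weak one of the
    ranks; hence ties can be left aside. *)
Definition unif i (w : T) : R := F (X i w).

Lemma measurable_unif i : measurable_fun setT (unif i).
Proof.
by apply: measurableT_comp => //; exact: continuous_measurable_fun.
Qed.

Lemma unif_ge0 i w : 0 <= unif i w. Proof. exact: F_ge0. Qed.
Lemma unif_le1 i w : unif i w <= 1. Proof. exact: F_le1. Qed.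

Lemma prob_X_gt i x : P [set w | x < X i w] = (1 - F x)%:E.
Proof.
have -> : [set w | x < X i w] = ~` (X i @^-1` `]-oo, x]).
  apply/seteqP; split => w /=; rewrite in_itv/= ltNge; first by move/negP.
  by move/negP.
rewrite probability_setC; last first.
  by rewrite -[X in measurable X]setTI; exact: measurable_funPT.
by have := hXF i x; rewrite /cdf /distribution /pushforward => ->.
Qed.

(** As F may be flat, the event F (X i) > r need not be X i > s for a single
    s: it is squeezed between the events X i > s with F s = r and with F s
    slightly larger than r. *)
Lemma prob_unif_gt i r : 0 <= r < 1 -> P [set w | r < unif i w] = (1 - r)%:E.
Proof.
move=> /andP[r0 r1].
have mU q : measurable [set w | q < unif i w].
  rewrite [X in measurable X](_ : _ = setT `&` unif i @^-1` `]q, +oo[).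
    exact: measurable_unif.
  by rewrite setTI; apply/seteqP; split => w /=; rewrite in_itv/= andbT.
have mX q : measurable [set w | q < X i w].
  rewrite [X in measurable X](_ : _ = setT `&` X i @^-1` `]q, +oo[).
    exact: measurable_funPT.
  by rewrite setTI; apply/seteqP; split => w /=; rewrite in_itv/= andbT.
apply/eqP; rewrite eq_le; apply/andP; split.
  move: r0; rewrite [0 <= r]le_eqVlt => /predU1P[<-|r0].
    by rewrite subr0; exact: probability_le1.
  have [s sr] : exists s, F s = r by apply: F_surj01; rewrite r0.
  rewrite -sr -(prob_X_gt i); apply: le_measure; rewrite ?inE//.
  by move=> w /=; exact: F_lt.
apply/lee_addgt0Pr => e e0.
pose q := r + Num.min e (1 - r) / 2.
have me : 0 < Num.min e (1 - r) by rewrite lt_min e0 subr_gt0.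
have me1 : Num.min e (1 - r) <= e by rewrite ge_min lexx.
have me2 : Num.min e (1 - r) <= 1 - r by rewrite ge_min lexx orbT.
have [s sq] : exists s, F s = q by apply: F_surj01; apply/andP; split; rewrite /q; lra.
apply: (@le_trans _ _ ((1 - q)%:E + e%:E)).
  by rewrite -EFinD lee_fin /q; lra.
rewrite leeD2r// -sq -(prob_X_gt i); apply: le_measure; rewrite ?inE//.
move=> w /= sw; rewrite (@lt_le_trans _ _ (F s))//; first by rewrite sq /q; lra.
by rewrite F_homo// ltW.
Qed.

Lemma unif_uniform i A : measurable A -> P (unif i @^-1` A) = uniform_prob (@ltr01 R) A.
Proof.
move=> mA.
(* Lebesgue measure lives on [measurableTypeR R], a measurable structure distinct
   from the default one of [R]: the rank is packed with that codomain. *)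
have mV : @measurable_fun _ _ T (measurableTypeR R) setT (unif i) := measurable_unif i.
pose V : {mfun T >-> measurableTypeR R} :=
  HB.pack (unif i : T -> measurableTypeR R)
    (isMeasurableFun.Build _ _ T (measurableTypeR R) (unif i) mV).
rewrite -[LHS]/(distribution P V A).
apply: (@measure_unique _ R (measurableTypeR R) (@RGenOInfty.G R)
  (fun n => `]- n%:R, +oo[%classic)
  _ _ _ _ (distribution P V) (uniform_prob (@ltr01 R))) => //.
- exact: RGenOInfty.measurableE.
- move=> _ _ [x ->] [y ->]; exists (Num.max x y).
  apply/seteqP; split => z /=; rewrite !in_itv/= !andbT gt_max.
    by move=> [-> ->].
  by move/andP.
- by move=> n; exists (- n%:R).
- rewrite -subTset => x _; exists (Num.truncn `|x|).+1 => //=.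
  rewrite in_itv/= andbT ltrNl (le_lt_trans (ler_norm _))// normrN.
  exact: truncnS_gt.
- move=> _ [r ->]; set I : set R := `]r, +oo[%classic.
  have mI : @measurable _ (measurableTypeR R) I := measurable_itv _.
  have unifE : uniform_prob (@ltr01 R) I = lebesgue_measure (I `&` `[0, 1]).
    apply: (@etrans _ _ (\int[uniform_prob (@ltr01 R)]_x (\1_I x)%:E)%E).
      rewrite integral_indic//; congr (uniform_prob _ _).
      by rewrite predeqE => x; split => [|[]].
    apply: (etrans (integral_uniform _ _ _)).
    - exact/measurable_EFinP/measurable_indic.
    - by move=> x; rewrite lee_fin.
    - by rewrite subr0 invr1 mul1e integral_indic.
  have distE : distribution P V I = P [set w | r < unif i w].
    by congr (P _); apply/seteqP; split => w /=; rewrite /I/= in_itv/= andbT.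
  apply: (etrans distE); apply: (etrans _ (esym unifE)).
  have [r1|r1] := leP 1 r.
    rewrite (_ : [set w | _] = set0) ?measure0; last first.
      by rewrite -subset0 => w /=; rewrite ltNge (le_trans (unif_le1 i w) r1).
    rewrite (_ : _ `&` _ = set0) ?measure0//.
    rewrite -subset0 => x /= []; rewrite /I/= !in_itv/= andbT => rx /andP[_ x1].
    by have := lt_le_trans (le_lt_trans r1 rx) x1; rewrite ltxx.
  have [r0|r0] := ltP r 0.
    rewrite (_ : [set w | _] = setT) ?probability_setT; last first.
      by rewrite -subTset => w _ /=; rewrite (lt_le_trans r0 (unif_ge0 i w)).
    rewrite setIidr ?lebesgue_measure_itv/= ?lte_fin ?ltr01 ?oppr0 ?adde0//.
    move=> x /=; rewrite /I/= !in_itv/= andbT => /andP[x0 _].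
    exact: lt_le_trans r0 x0.
  rewrite prob_unif_gt ?r0//.
  rewrite (_ : _ `&` _ = `]r, 1%R]%classic).
    by rewrite lebesgue_measure_itv/= lte_fin r1 EFinB.
  apply/seteqP; split => x /=; rewrite /I/= !in_itv/= andbT.
    by move=> [-> /andP[_ ->]].
  by move=> /andP[rx x1]; split => //; rewrite x1 andbT ltW// (le_lt_trans r0).
- by move=> k; rewrite (le_lt_trans (probability_le1 _ _))// ltry.
Qed.

Lemma integral_unif i (g : R -> \bar R) : measurable_fun setT g ->
  (forall u, 0 <= g u)%E ->
  (\int[P]_w g (unif i w) = \int[lebesgue_measure]_(u in `[0%R, 1%R]) g u)%E.
Proof.
move=> mg g0.
have mV : @measurable_fun _ _ T (measurableTypeR R) setT (unif i) := measurable_unif i.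
pose V : {mfun T >-> measurableTypeR R} :=
  HB.pack (unif i : T -> measurableTypeR R)
    (isMeasurableFun.Build _ _ T (measurableTypeR R) (unif i) mV).
have := @ge0_integral_distribution _ _ T (measurableTypeR R) R P V g mg g0.
rewrite /comp /= => <-.
rewrite (@eq_measure_integral _ _ _ setT (uniform_prob (@ltr01 R))); last first.
  by move=> A mA _; exact: unif_uniform.
by rewrite integral_uniform// subr0 invr1 mul1e.
Qed.

End uniformization.

(** * Independence of the past and a new observation *)

Section independence.
Context (d : measure_display) (T : measurableType d) (R : realType)
  (P : probability T R) (X : nat -> {RV P >-> R}).
Hypothesis hX : independent_seq X.

(** Cylinders over the first i observations: the product rule for them is the
    independence assumption itself. *)
Let G i : set (set T) := [set A | exists2 B : nat -> set R,
  (forall j, measurable (B j)) & A = \bigcap_(j in `I_i) (X j @^-1` B j)].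

Let mX j (B : set R) : measurable B -> measurable (X j @^-1` B).
Proof. by move=> mB; rewrite -[X in measurable X]setTI; exact: measurable_funPT. Qed.

Lemma filtration_sub_cylinders i :
  natural_filtration X i `<=` <<s G i >>.
Proof.
apply: smallest_sub; first exact: smallest_sigma_algebra.
elim/big_ind: _ => [//|A B AG BG C [/AG|/BG]//|j _ _ [B mB <-]].
apply: sub_sigma_algebra; exists (fun k : nat => if k == j then B else setT).
  by move=> k; case: ifP.
apply/seteqP; split => w /=.
  by move=> [_ hB] k /= ki; case: eqP => // ->.
by move=> /(_ j (ltn_ord j)); rewrite eqxx.
Qed.

Let indep_cylinder i A B : G i A -> measurable B ->
  P (A `&` X i @^-1` B) = (P A * P (X i @^-1` B))%E.
Proof.
move=> [B_ mB_ ->] mB.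
pose B' j := if j == i then B else B_ j.
have mB' j : measurable (B' j) by rewrite /B'; case: ifP.
pose J : {fset nat} := [fset j in iota 0 i]%fset.
have JE j : (j \in J) = (j < i)%N by rewrite !inE /= mem_iota.
have iJ : i \notin J by rewrite JE ltnn.
have := hX (i |` J)%fset mB'; rewrite big_fsetU1//= -(hX J mB').
have -> : \bigcap_(j in [set` J]) (X j @^-1` B' j) =
    \bigcap_(j in `I_i) (X j @^-1` B_ j).
  have JI : [set` J] = `I_i by apply/seteqP; split => j /=; rewrite JE.
  by rewrite JI; apply: eq_bigcapr => j /= ji; rewrite /B' ltn_eqF.
have -> : \bigcap_(j in [set` (i |` J)%fset]) (X j @^-1` B' j) =
    \bigcap_(j in `I_i) (X j @^-1` B_ j) `&` X i @^-1` B.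
  apply/seteqP; split => w /=.
    move=> h; split => [j /= ji|].
      have /= := h j; rewrite /B' ltn_eqF//; apply.
      by rewrite /= in_fset1U JE ji orbT.
    by have /= := h i; rewrite /B' eqxx; apply; rewrite /= in_fset1U eqxx.
  move=> [h hi] j /=; rewrite in_fset1U JE => /orP[/eqP ->|ji].
    by rewrite /B' eqxx.
  by rewrite /B' ltn_eqF//; exact: h.
by rewrite {1}/B' eqxx muleC.
Qed.

Lemma filtration_measurable i A : natural_filtration X i A -> measurable A.
Proof.
move=> /filtration_sub_cylinders; apply: smallest_sub => //.
  exact: sigma_algebra_measurable.
move=> _ [B mB ->]; apply: bigcap_measurableType => // j _; exact: mX.
Qed.

(** Both sides are finite measures in A, and they agree on the pi-system of
    cylinders, which generates the past. *)
Lemma indep_filtration i A B : natural_filtration X i A -> measurable B ->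
  P (A `&` X i @^-1` B) = (P A * P (X i @^-1` B))%E.
Proof.
move=> /filtration_sub_cylinders FA mB.
have pf : P (X i @^-1` B) \is a fin_num by rewrite fin_num_measure//; exact: mX.
pose r : {nonneg R} := NngNum (fine_ge0 (measure_ge0 P (X i @^-1` B))).
have rE : (r%:num)%:E = P (X i @^-1` B) by rewrite /= fineK.
have -> : (P A * P (X i @^-1` B))%E = mscale r P A.
  by rewrite /mscale rE muleC.
rewrite -[LHS]/(mrestr P (mX i mB) A).
apply: (@g_sigma_algebra_measure_unique _ R T (G i) _ (fun _ => setT)) => //.
- move=> _ [C mC ->]; apply: bigcap_measurableType => // j _; exact: mX.
- by move=> _; exists (fun _ => setT) => //; apply/seteqP; split.
- by rewrite -subTset => w _; exists 0.
- move=> _ _ [C mC ->] [D mD ->]; exists (fun j => C j `&` D j).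
    by move=> j; exact: measurableI.
  by rewrite -bigcapI; apply: eq_bigcapr.
- move=> C GC; have := indep_cylinder GC mB.
  by rewrite /mrestr /= /mscale rE muleC.
- move=> _; rewrite /mrestr (le_lt_trans (probability_le1 _ _)) ?ltry//.
  by apply: measurableI => //; exact: mX.
Qed.

Definition adapted d' (S : measurableType d') i (Z : T -> S) :=
  forall B, measurable B -> natural_filtration X i (Z @^-1` B).

(** The sample space with the sigma-algebra of the past, so that measurability
    of compositions, pairs and conditionals applies to adapted functions. *)
Definition past i := g_sigma_algebraType
  (\big[setU/set0]_(j < i) preimage_set_system setT (X j : T -> R) measurable).

Lemma adaptedP d' (S : measurableType d') i (Z : T -> S) :
  adapted i Z <-> measurable_fun setT (Z : past i -> S).
Proof.
split=> [aZ _ B mB|mZ B mB].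
  by rewrite setTI; exact: aZ.
by have /= := mZ measurableT B mB; rewrite setTI.
Qed.

Lemma adapted_measurable d' (S : measurableType d') i (Z : T -> S) :
  adapted i Z -> measurable_fun setT Z.
Proof. by move=> aZ _ B mB; rewrite setTI; apply: filtration_measurable; exact: aZ. Qed.

Lemma filtrationS i : natural_filtration X i `<=` natural_filtration X i.+1.
Proof.
apply: smallest_sub; first exact: smallest_sigma_algebra.
rewrite /natural_filtration /g_sigma_preimage big_ord_recr /=.
by move=> A hA; apply: sub_sigma_algebra; left.
Qed.

Lemma adaptedS d' (S : measurableType d') i (Z : T -> S) :
  adapted i Z -> adapted i.+1 Z.
Proof. by move=> aZ B mB; apply: filtrationS; exact: aZ. Qed.

Lemma adapted_X i : adapted i.+1 (X i : T -> R).
Proof.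
move=> B mB; apply: sub_sigma_algebra; rewrite big_ord_recr /=; right.
by exists B => //; rewrite setTI.
Qed.

(** This plays the part of conditional expectation: given the past, the new
    observation can be averaged out separately. The law of the pair is a
    product measure, and Tonelli applies. *)
Lemma integral_fresh d' (S : measurableType d') i (Z : T -> S)
    (g : S * R -> \bar R) :
  adapted i Z -> measurable_fun setT g -> (forall z, 0 <= g z)%E ->
  (\int[P]_w g (Z w, X i w) = \int[P]_w \int[P]_w' g (Z w, X i w'))%E.
Proof.
move=> aZ mg g0.
pose Z' : {mfun T >-> S} :=
  HB.pack Z (isMeasurableFun.Build _ _ _ _ Z (adapted_measurable aZ)).
have mZX : measurable_fun setT (fun w => (Z w, X i w)).
  by apply: measurable_fun_pair => //; exact: adapted_measurable aZ.
pose ZX : {mfun T >-> (S * R)%type} :=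
  HB.pack (fun w => (Z w, X i w)) (isMeasurableFun.Build _ _ _ _ _ mZX).
rewrite -[LHS]/(\int[P]_w (g \o ZX) w)%E -ge0_integral_distribution//.
rewrite -(@eq_measure_integral _ _ _ setT _
  (distribution P Z' \x distribution P (X i))%E); last first.
  move=> A mA _; apply: product_measure_unique mA => B C mB mC.
  by rewrite -(indep_filtration (aZ _ mB) mC).
rewrite fubini_tonelli1// /fubini_F.
rewrite ge0_integral_distribution//; last 2 first.
- exact: measurable_fun_fubini_tonelli_F.
- by move=> z; exact: integral_ge0.
apply: eq_integral => w _ /=.
rewrite ge0_integral_distribution//; exact: measurable_fun_pair2.
Qed.

End independence.

(** * Mean cost of one threshold decision *)

Section one_step.
Variable R : realType.
Local Notation mu := (@lebesgue_measure R).

Lemma integral_inv_1B (v a b : R) (s : bool) : a < b -> b < 1 ->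
  (\int[mu]_(u in [set` Interval (BSide s a) (BRight b)]) (v / (1 - u))%:E =
   (v * (ln (1 - a) - ln (1 - b)))%:E)%E.
Proof.
move=> ab b1.
pose G (u : R) : R := - v * ln (1 - u).
have dG (u : R) : u <= b -> is_derive u 1 G (v / (1 - u)).
  move=> ub; have u0 : 0 < 1 - u by rewrite subr_gt0 (le_lt_trans ub).
  have d1 : is_derive u 1 (fun u : R => 1 - u) (- 1).
    by apply: is_derive_eq; rewrite /=; ring.
  have d2 := @is_derive1_comp R (@ln R) (fun u => 1 - u) u _ _ (is_derive1_ln u0) d1.
  have d3 : is_derive u 1 (fun u : R => ln (1 - u)) ((1 - u)^-1 * -1) := d2.
  rewrite /G; apply: is_derive_eq; rewrite /GRing.scale /=; ring.
have cf : {within `[a, b], continuous (fun u : R => v / (1 - u))}.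
  apply: continuous_in_subspaceT => u; rewrite inE/= in_itv/= => /andP[_ ub].
  apply: cvgM; first exact: cvg_cst.
  apply: cvgV; first by rewrite gt_eqF// subr_gt0 (le_lt_trans ub).
  by apply: cvgB => //; exact: cvg_cst.
have mf : measurable_fun `[a, b] (fun u : R => (v / (1 - u))%:E).
  by apply/measurable_EFinP; apply: subspace_continuous_measurable_fun.
transitivity (\int[mu]_(u in `[a, b]) (v / (1 - u))%:E)%E.
  case: s => //; rewrite integral_itv_obnd_cbnd//.
  by apply: measurable_funS mf => //; exact: subset_itv_oc_cc.
have cG u : u <= b -> {for u, continuous G}.
  move=> ub; have [dv _] := dG u ub.
  by apply: differentiable_continuous; exact/derivable1_diffP.
rewrite (@continuous_FTC2 _ _ G) //.
- by rewrite -EFinB /G; congr EFin; ring.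
- split.
  + by move=> u; rewrite in_itv/= => /andP[_ /ltW/dG[]].
  + by apply: cvg_at_right_filter; apply: cG; exact: ltW.
  + by apply: cvg_at_left_filter; apply: cG.
- move=> u; rewrite in_itv/= => /andP[_ /ltW/dG du].
  by rewrite derive1E; apply: derive_val.
Qed.

Lemma measurable_inv : measurable_fun setT (@GRing.inv R).
Proof.
have -> : @GRing.inv R = fun x => if 0 < x then expR (- ln x) else
    if x < 0 then - expR (- ln (- x)) else 0.
  apply/funext => x; case: ifPn => [x0|].
    by rewrite expRN lnK.
  rewrite -leNgt le_eqVlt => /predU1P[->|x0]; first by rewrite ltxx invr0.
  by rewrite x0 expRN lnK ?posrE ?oppr_gt0// invrN opprK.
have mlt0 : measurable_fun setT (fun x : R => 0 < x) by exact: measurable_fun_ltr.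
have mgt0 : measurable_fun setT (fun x : R => x < 0) by exact: measurable_fun_ltr.
apply: measurable_fun_ifT => //.
  apply: measurableT_comp => //; apply: measurableT_comp => //.
apply: measurable_fun_ifT => //.
apply: measurableT_comp => //; apply: measurableT_comp => //.
by do 2 apply: measurableT_comp => //.
Qed.

Lemma measurable_funV d (T : measurableType d) (f : T -> R) :
  measurable_fun setT f -> measurable_fun setT (fun x => (f x)^-1).
Proof. exact: measurableT_comp measurable_inv. Qed.

(** The cost to come after an observation of rank u, if n.+1 selections remain
    and rho is the mass of the ranks above the current level 1 - rho:
    selecting inside the optimal window, passing outside. The boolean closes
    the window on the left: the lower bound compares with ranks that are at
    least the level, whereas the policy needs ranks that exceed it. *)
Definition threshold_cost (s : bool) n (rho u : R) : R :=
  if u \in Interval (BSide s (1 - rho)) (BRight (1 - rho + width R n.+1 * rho))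
  then value R n / (1 - u) else value R n.+1 / rho.

Lemma measurable_threshold_cost s n rho : measurable_fun setT (threshold_cost s n rho).
Proof.
apply: measurable_fun_ifT => //.
  set a := 1 - rho; set b := a + _.
  rewrite (_ : (fun u => _) =
      fun u : R => ((if s then a <= u else a < u) && (u <= b))); last first.
    by apply/funext => u; rewrite in_itv/=; case: (s).
  apply: measurable_and; last exact: measurable_fun_ler.
  by case: (s); [exact: measurable_fun_ler|exact: measurable_fun_ltr].
apply: measurable_funM => //; apply: measurable_funV.
exact: measurable_funB.
Qed.

Lemma threshold_cost_ge0 s n rho u : 0 < rho -> u <= 1 -> 0 <= threshold_cost s n rho u.
Proof.
move=> r0 u1; rewrite /threshold_cost; case: ifP => _.
  by rewrite divr_ge0 ?value_ge0// subr_ge0.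
by rewrite divr_ge0 ?value_ge0// ltW.
Qed.

(** The Bellman equation. By scaling, the window contributes - value n * ln (1
    - t) whatever rho, and its complement has mass 1 - t * rho, so that the
    equation reduces to [width_eq]. *)
Lemma integral_threshold_cost s n rho : 0 < rho <= 1 ->
  (1 + \int[mu]_(u in `[0%R, 1%R]) (threshold_cost s n rho u)%:E =
   (value R n.+1 / rho)%:E)%E.
Proof.
move=> /andP[r0 r1].
set t := width R n.+1.
have t0 : 0 < t := width_gt0 R n.
have t1 : t <= 1 := width_le1 R n.
set a := 1 - rho; set b := 1 - rho + t * rho.
have ab : a < b by rewrite ltrDl mulr_gt0.
have b1 : b <= 1 by have := ler_wpM2r (ltW r0) t1; rewrite mul1r /b; lra.
have a0 : 0 <= a by rewrite subr_ge0.
set I := [set` Interval (BSide s a) (BRight b)].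
have I01 : I `<=` `[0%R, 1%R].
  move=> u; rewrite /I /= !in_itv/= => /andP[au ub]; apply/andP; split.
    by rewrite (le_trans a0)//; case: (s) au => //= /ltW.
  exact: le_trans ub b1.
have mI : @measurable _ (measurableTypeR R) I := measurable_itv _.
have v0 := value_ge0 R n; have v1 := valueS_gt0 R n.
have mq : @measurable_fun _ _ (measurableTypeR R) _ setT
    (fun u : R => (threshold_cost s n rho u)%:E).
  by apply/measurable_EFinP; exact: measurable_threshold_cost.
have q0 u : `[0%R, 1%R]%classic u -> (0 <= (threshold_cost s n rho u)%:E)%E.
  by rewrite /= in_itv/= => /andP[_ u1]; rewrite lee_fin threshold_cost_ge0.
have -> : `[0%R, 1%R]%classic = I `|` (`[0%R, 1%R] `\` I).
  by rewrite setUDr setUC setUidl// setDv setD0.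
rewrite ge0_integral_setU//=; first last.
- by rewrite disj_set2E; apply/eqP; rewrite setDE setICA setICr setI0.
- by move=> x hx; apply: q0; case: hx => [/I01//|[]].
- exact: measurable_funS mq.
- by apply: measurableD.
have -> : (\int[mu]_(u in I) (threshold_cost s n rho u)%:E =
    (- value R n * ln (1 - t))%:E)%E.
  transitivity (\int[mu]_(u in I) (value R n / (1 - u))%:E)%E.
    apply: eq_integral => u; rewrite inE /I /= => uI.
    by rewrite /threshold_cost uI.
  have [n0|n0] := eqVneq (value R n) 0.
    rewrite n0 oppr0 mul0r; under eq_integral do rewrite mul0r.
    by rewrite integral0.
  have t1' : t < 1.
    by rewrite /t /width /= ltrBlDr ltrDl divr_gt0// lt_neqAle eq_sym n0.
  have b1' : b < 1 by have : t * rho < 1 * rho; [rewrite ltr_pM2r|rewrite /b; lra].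
  rewrite integral_inv_1B//; congr EFin.
  have -> : 1 - b = rho * (1 - t) by rewrite /b; ring.
  have -> : 1 - a = rho by rewrite /a; ring.
  rewrite lnM ?posrE ?subr_gt0//; ring.
have -> : (\int[mu]_(u in `[0%R, 1%R] `\` I) (threshold_cost s n rho u)%:E =
    (value R n.+1 / rho * (1 - t * rho))%:E)%E.
  transitivity (\int[mu]_(u in `[0%R, 1%R] `\` I) (cst (value R n.+1 / rho)%:E) u)%E.
    apply: eq_integral => u; rewrite inE /I /= => -[_ /negP/negbTE uI].
    by rewrite /threshold_cost uI.
  rewrite integral_cst; last exact: measurableD.
  rewrite [RHS]EFinM; congr (_ * _)%E.
  rewrite measureD//=; last by rewrite lebesgue_measure_itv/= lte_fin ltr01 ltry.
  rewrite setIidr// !lebesgue_measure_itv/= !lte_fin ltr01 ab.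
  by rewrite -!EFinB; congr EFin; rewrite /b /a; ring.
rewrite -!EFinD; congr EFin.
have := width_eq R n; rewrite -/t => e.
have -> : value R n.+1 / rho * (1 - t * rho) =
    value R n.+1 / rho - value R n.+1 * t by field; lra.
rewrite -[next_value _]/(value R n.+1) e; ring.
Qed.
End one_step.

(** * The truncated potential *)

Section potential.
Variable R : realType.
Local Notation mu := (@lebesgue_measure R).
Implicit Types (c x u : R) (k n : nat).

(** For k > 0 this is the smaller of value k / (1 - x) and 1 / c, in a form
    that makes sense at x = 1; c = 0 stands for no truncation. The quotient
    value k / (1 - x) is the optimal mean time for k more selections above
    level x, since the ranks above x are again uniform and are met at rate 1 -
    x. It is not integrable over x, hence the truncation in the lower bound. *)
Definition potential c k x : R := value R k / Num.max (1 - x) (c * value R k).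

Lemma potential_ge0 c k x : 0 <= c -> 0 <= potential c k x.
Proof.
move=> c0; rewrite /potential divr_ge0 ?value_ge0//.
by rewrite le_max [X in _ || X]mulr_ge0 ?value_ge0// orbT.
Qed.

Lemma potential0 c x : potential c 0 x = 0.
Proof. by rewrite /potential /= mul0r. Qed.

Lemma potential_le c k x : 0 < c -> potential c k x <= c^-1 * (0 < k)%:R.
Proof.
move=> c0; case: k => [|k]; first by rewrite potential0 mulr0.
rewrite mulr1 /potential; have v0 := valueS_gt0 R k.
have cv : 0 < c * value R k.+1 by rewrite mulr_gt0.
rewrite ler_pdivrMr; last by rewrite lt_max cv orbT.
apply: (@le_trans _ _ (c^-1 * (c * value R k.+1))).
  by rewrite mulKf ?gt_eqF.
by apply: ler_wpM2l; [rewrite invr_ge0 ltW|rewrite le_max lexx orbT].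
Qed.

(** The smallest potential that any decision can leave after an observation of
    rank u; selecting is possible from the level upwards. *)
Definition best_next c (s : nat * R) u : R :=
  if s.2 <= u then Num.min (potential c s.1 s.2) (potential c s.1.-1 u)
  else potential c s.1 s.2.

Lemma best_next_ge0 c s u : 0 <= c -> 0 <= best_next c s u.
Proof.
by move=> c0; rewrite /best_next; case: ifP => _; rewrite ?le_min !potential_ge0.
Qed.

(** Truncation amounts to enlarging the mass 1 - x above the level to rho. The
    window for rho ends where 1 - u = z := rho * value n / value n.+1, that is
    where value n / (1 - u) reaches value n.+1 / rho. Both cases are decided
    by comparing 1 - u with z, and z >= c * value n. *)
Lemma threshold_cost_le_best c n x u (rho := Num.max (1 - x) (c * value R n.+1)) :
  0 < c -> u <= 1 -> threshold_cost true n rho u <= best_next c (n.+1, x) u.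
Proof.
move=> c0 u1.
have v0 := value_ge0 R n; have v1 := valueS_gt0 R n.
have cv : c * value R n.+1 <= rho by rewrite le_max lexx orbT.
have r0 : 0 < rho by apply: lt_le_trans cv; rewrite mulr_gt0.
have xr : 1 - x <= rho by rewrite le_max lexx.
set y := value R n.+1 in v1 cv *; set v := value R n in v0 *.
pose z := rho * (v / y).
have cz : c * v <= z.
  have -> : c * v = c * y * (v / y) by field; rewrite gt_eqF.
  by apply: ler_wpM2r => //; rewrite divr_ge0// ltW.
have bE : 1 - (1 - rho + width R n.+1 * rho) = z.
  by rewrite /width -/y [n.+1.-1]/= -/v /z; ring.
set a := 1 - rho in bE *; set b := a + width R n.+1 * rho in bE *.
have in_accept : u <= b -> v / (1 - u) <= y / rho.
  move: v0; rewrite le_eqVlt => /predU1P[<- _|vp ub].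
    by rewrite mul0r divr_ge0// ltW.
  have zp : 0 < z by rewrite mulr_gt0// divr_gt0.
  have -> : y / rho = v / z by rewrite /z; field; rewrite !gt_eqF.
  by apply: ler_wpM2l; [exact: ltW|rewrite lef_pV2 ?posrE; lra].
have le_last : threshold_cost true n rho u <= y / rho.
  rewrite /threshold_cost; case: ifPn => //; rewrite in_itv/= => /andP[_ ub].
  exact: in_accept.
rewrite /best_next /=; case: ifPn => [xu|_]; last exact: le_last.
rewrite le_min le_last /=.
rewrite /threshold_cost in_itv/= -/a -/b -/v -/y.
have -> : a <= u by rewrite /a; lra.
rewrite /potential -/v /=; case: ifPn => ub.
  (* Inside the window 1 - u >= z >= c v: the new potential is not truncated. *)
  by rewrite max_l//; lra.
move: v0; rewrite le_eqVlt => /predU1P[v0|vp].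
  move: bE; rewrite /z -v0 mul0r mulr0; lra.
have zp : 0 < z by rewrite mulr_gt0// divr_gt0.
have -> : y / rho = v / z by rewrite /z; field; rewrite !gt_eqF.
have m0 : Num.max (1 - u) (c * v) <= z by rewrite ge_max cz andbT; lra.
apply: ler_wpM2l; first exact: ltW.
by rewrite lef_pV2 ?posrE// lt_max [X in _ || X]mulr_gt0 ?orbT.
Qed.

Lemma measurable_nat d (T : measurableType d) (g : nat -> T) : measurable_fun setT g.
Proof. by []. Qed.

Lemma measurable_potential c d (T : measurableType d) (k : T -> nat) (x : T -> R) :
  measurable_fun setT k -> measurable_fun setT x ->
  measurable_fun setT (fun w => potential c (k w) (x w)).
Proof.
move=> mk mx.
have mv : measurable_fun setT (fun w => value R (k w)).
  exact: (measurableT_comp (measurable_nat (value R)) mk).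
apply: measurable_funM => //; apply: measurable_funV.
apply: measurable_maxr; first exact: measurable_funB.
exact: measurable_funM.
Qed.

Lemma measurable_best_next c d (T : measurableType d) (s : T -> nat * R) (u : T -> R) :
  measurable_fun setT s -> measurable_fun setT u ->
  measurable_fun setT (fun w => best_next c (s w) (u w)).
Proof.
move=> ms mu_.
have m1 : measurable_fun setT (fun w => (s w).1) by exact: measurableT_comp ms.
have m2 : measurable_fun setT (fun w => (s w).2) by exact: measurableT_comp ms.
apply: measurable_fun_ifT; first exact: measurable_fun_ler.
  apply: measurable_minr; first exact: measurable_potential.
  apply: measurable_potential => //.
  exact: (measurableT_comp (measurable_nat predn) m1).
exact: measurable_potential.
Qed.

(** The truncated potential is still a subsolution of the Bellman equation. *)
Lemma potential_le_best c k x : 0 < c -> c * value R k <= 1 -> 0 <= x ->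
  ((potential c k x)%:E <= (0 < k)%:R%:E +
    \int[mu]_(u in `[0%R, 1%R]) (best_next c (k, x) u)%:E)%E.
Proof.
move=> c0; case: k => [_ _|n cv x0].
  rewrite potential0 add0e; apply: integral_ge0 => u _.
  by rewrite lee_fin best_next_ge0// ltW.
rewrite {1}/potential; set rho := Num.max _ _.
have r1 : 0 < rho <= 1.
  by rewrite ge_max cv lt_max [X in _ || X]mulr_gt0 ?valueS_gt0// orbT /= andbT; lra.
rewrite -(integral_threshold_cost true n r1) leeD2l//.
have mb : measurable_fun setT (fun u : R => (best_next c (n.+1, x) u)%:E).
  by apply/measurable_EFinP; exact: measurable_best_next.
have ma : measurable_fun setT (fun u : R => (threshold_cost true n rho u)%:E).
  by apply/measurable_EFinP; exact: measurable_threshold_cost.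
apply: ge0_le_integral => //.
- move=> u /=; rewrite in_itv/= => /andP[_ u1].
  by rewrite lee_fin threshold_cost_ge0//; case/andP: r1.
- exact: measurable_funTS ma.
- exact: measurable_funTS mb.
- move=> u /=; rewrite in_itv/= => /andP[_ u1].
  by rewrite lee_fin threshold_cost_le_best.
Qed.
End potential.

(** * Runs of a selection rule *)

Section run.
Context (d : measure_display) (T : measurableType d) (R : realType)
  (P : probability T R) (X : nat -> {RV P >-> R}) (F : R -> R).
Hypothesis hF : continuous F.
Hypothesis hXF : forall (i : nat) (r : R), cdf (X i) r = (F r)%:E.
Hypothesis hX : independent_seq X.
Local Notation unif := (unif X F).

Variables (n : nat) (rule : nat -> T -> nat * R -> bool).

(** The pair (selections to make, level) after i observations. The rule sees
    the outcome as well as the state: a threshold policy decides from the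
    state and the rank, an arbitrary policy from its stopping times. *)
Fixpoint run i w : nat * R :=
  if i is j.+1 then
    let s := run j w in if rule j w s then (s.1.-1, unif j w) else s
  else (n, 0).

Lemma run_le i w : ((run i w).1 <= n)%N.
Proof. elim: i => //= i ih; case: ifP => //= _; lia. Qed.

Lemma run_ge0 i w : 0 <= (run i w).2.
Proof. by elim: i => //= i ih; case: ifP => //= _; exact: unif_ge0. Qed.

Lemma adapted_unif i : adapted X i.+1 (unif i).
Proof.
have aX := @adapted_X _ _ _ _ X i; apply/adaptedP; move/adaptedP : aX => aX.
by apply: (measurableT_comp _ aX); exact: continuous_measurable_fun.
Qed.

Hypothesis rule_adapted : forall i, adapted X i (run i) ->
  adapted X i.+1 (fun w => rule i w (run i w)).

Lemma adapted_run i : adapted X i (run i).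
Proof.
elim: i => [|i ih]; first by apply/adaptedP; exact: measurable_cst.
have /adaptedP mr := rule_adapted ih.
have /adaptedP ms := adaptedS ih.
have /adaptedP mU := @adapted_unif i.
apply/adaptedP => /=; apply: measurable_fun_ifT => //.
apply: measurable_fun_pair => //.
apply: (measurableT_comp (measurable_nat predn)).
exact: (measurableT_comp measurable_fst ms).
Qed.

Lemma measurable_run i : measurable_fun setT (run i).
Proof. exact: adapted_measurable (@adapted_run i). Qed.

Lemma measurable_running i : measurable_fun setT (fun w => ((0 < (run i w).1)%:R : R)).
Proof.
have m1 : measurable_fun setT (fun w => (run i w).1).
  exact: (measurableT_comp measurable_fst (measurable_run i)).
exact: (measurableT_comp (measurable_nat (fun k => (0 < k)%:R : R)) m1).
Qed.

Lemma measurable_run_potential c i :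
  measurable_fun setT (fun w => potential c (run i w).1 (run i w).2).
Proof.
have ms := measurable_run i; apply: measurable_potential.
  exact: (measurableT_comp measurable_fst ms).
exact: (measurableT_comp measurable_snd ms).
Qed.

Let measurable_comp_F (g : nat * R -> R -> R) :
  measurable_fun setT (fun z : (nat * R) * R => g z.1 z.2) ->
  measurable_fun setT (fun z : (nat * R) * R => (g z.1 (F z.2))%:E).
Proof.
move=> mg; apply/measurable_EFinP.
have mp : measurable_fun setT (fun z : (nat * R) * R => (z.1, F z.2)).
  apply: measurable_fun_pair => //.
  by apply: measurableT_comp => //; exact: continuous_measurable_fun.
exact: (measurableT_comp mg mp).
Qed.

Lemma integral_fresh_unif (g : nat * R -> R -> R) i :
  measurable_fun setT (fun z : (nat * R) * R => g z.1 z.2) ->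
  (forall s u, 0 <= g s u) ->
  (\int[P]_w (g (run i w) (unif i w))%:E =
   \int[P]_w \int[lebesgue_measure]_(u in `[0%R, 1%R]) (g (run i w) u)%:E)%E.
Proof.
move=> mg g0.
have mgF := measurable_comp_F mg.
have := @integral_fresh _ _ _ _ X hX _ (nat * R)%type i (run i) _ (@adapted_run i) mgF.
move=> ->; last by move=> z; rewrite lee_fin.
apply: eq_integral => w _ /=.
rewrite -(@integral_unif _ _ _ _ X F hF hXF i
  (fun u => (g (run i w) u)%:E))//; last first.
  by move=> u; rewrite lee_fin.
apply/measurable_EFinP; exact: (measurableT_comp mg (pair1_measurable (run i w))).
Qed.

Lemma measurable_integral_unit (g : nat * R -> R -> R) :
  measurable_fun setT (fun z : (nat * R) * R => g z.1 z.2) ->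
  (forall s u, 0 <= g s u) ->
  measurable_fun setT (fun s =>
    (\int[lebesgue_measure]_(u in `[0%R, 1%R]) (g s u)%:E)%E).
Proof.
move=> mg g0.
have mgF := measurable_comp_F mg.
have := @measurable_fun_fubini_tonelli_F _ _ _ _ R (distribution P (X 0)) _ mgF.
have gF0 z : (0 <= (g z.1 (F z.2))%:E)%E by rewrite lee_fin.
move=> /(_ gF0); congr (measurable_fun _ _); apply/funext => s.
rewrite /fubini_F ge0_integral_distribution//; last first.
  exact: (measurableT_comp mgF (pair1_measurable s)).
rewrite -(@integral_unif _ _ _ _ X F hF hXF 0 (fun u => (g s u)%:E))//.
  apply/measurable_EFinP; exact: (measurableT_comp mg (pair1_measurable s)).
by move=> u; rewrite lee_fin.
Qed.

Section lower.
Variable c : R.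
Hypothesis c0 : 0 < c.
Hypothesis cn : c * value R n <= 1.
Hypothesis rule_above : forall i, {ae P, forall w, rule i w (run i w) ->
  (run i w).2 <= unif i w}.

(** Elapsed time plus potential is a submartingale: average
    [potential_le_best] over the new rank, and note that the decision taken
    leaves at least [best_next]. *)
Lemma potential_le_step i :
  (\int[P]_w (potential c (run i w).1 (run i w).2)%:E <=
   \int[P]_w ((0 < (run i w).1)%:R)%:E +
   \int[P]_w (potential c (run i.+1 w).1 (run i.+1 w).2)%:E)%E.
Proof.
have p0 k x : (0 <= (potential c k x)%:E)%E by rewrite lee_fin potential_ge0// ltW.
have mg : measurable_fun setT (fun z : (nat * R) * R => best_next c z.1 z.2).
  exact: measurable_best_next.
have g0 s u : 0 <= best_next c s u by rewrite best_next_ge0// ltW.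
have mpot j : measurable_fun setT
    (fun w => (potential c (run j w).1 (run j w).2)%:E).
  by apply/measurable_EFinP; exact: measurable_run_potential.
have mrun : measurable_fun setT (fun w => ((0 < (run i w).1)%:R : R)%:E).
  by apply/measurable_EFinP; exact: measurable_running.
have mb : measurable_fun setT (fun w => (best_next c (run i w) (unif i w))%:E).
  apply/measurable_EFinP; apply: measurable_best_next; first exact: measurable_run.
  exact: measurable_unif.
have mib : measurable_fun setT (fun w =>
  (\int[lebesgue_measure]_(u in `[0%R, 1%R]) (best_next c (run i w) u)%:E)%E).
  exact: (measurableT_comp (measurable_integral_unit mg g0) (measurable_run i)).
apply: (@le_trans _ _ (\int[P]_w ((0 < (run i w).1)%:R)%:E +
   \int[P]_w (best_next c (run i w) (unif i w))%:E)%E).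
  rewrite integral_fresh_unif// -ge0_integralD//; last first.
    by move=> w _; apply: integral_ge0 => u _; rewrite lee_fin.
  apply: ge0_le_integral => //.
  - by apply: emeasurable_funD.
  - move=> w _; case E : (run i w) => [k x].
    apply: potential_le_best => //.
    + apply: le_trans cn; apply: ler_wpM2l; first exact: ltW.
      by apply: value_homo; have := run_le i w; rewrite E.
    + by have := run_ge0 i w; rewrite E.
rewrite leeD2l//; apply: ae_ge0_le_integral => //.
- by move=> w _; rewrite lee_fin.
- have := rule_above i; apply: filterS => w up _.
  rewrite lee_fin /best_next /=; case: (rule i w (run i w)) up => [/(_ isT) ->|_ /=].
    by rewrite ge_min lexx orbT.
  by case: ifP => _ //; rewrite ge_min lexx.
Qed.

Lemma potential_le_sum i :
  ((potential c n 0)%:E <=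
   \int[P]_w (\sum_(0 <= j < i) (0 < (run j w).1)%:R)%:E +
   \int[P]_w (potential c (run i w).1 (run i w).2)%:E)%E.
Proof.
elim: i => [|i ih].
  under eq_integral do rewrite big_geq//.
  rewrite integral0 add0e /=.
  have -> := integral_cst P measurableT (potential c n 0)%:E.
  by rewrite [X in (_ * X)%E](@probability_setT _ _ _ P) mule1.
apply: (le_trans ih).
under [X in (_ <= X + _)%E]eq_integral do rewrite big_nat_recr//= EFinD.
rewrite ge0_integralD//.
- by rewrite -[leRHS]addeA; apply: leeD2l; exact: potential_le_step.
- by move=> w _; rewrite lee_fin sumr_ge0.
- apply/measurable_EFinP; apply: measurable_sum => j; exact: measurable_running.
- by apply/measurable_EFinP; exact: measurable_running.
Qed.
End lower.
End run.

(** * Random times as sums of indicators *)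

Section times.
Variable R : realType.

Lemma sum_ltn_nat (m i : nat) : \sum_(0 <= j < i) ((j < m)%N%:R : R) = (minn i m)%:R.
Proof.
elim: i => [|i ih]; first by rewrite big_geq// min0n.
rewrite big_nat_recr//= ih -natrD; congr _%:R.
by case: ltnP => /=; lia.
Qed.

Lemma time_ereal_ge_sum (t : option nat) i :
  ((\sum_(0 <= j < i) (~~ time_le t j)%:R)%:E <= time_ereal R t)%E.
Proof.
case: t => [m|] /=; last by rewrite leey.
under eq_bigr do rewrite -ltnNge.
by rewrite sum_ltn_nat lee_fin ler_nat geq_minr.
Qed.

(** This expresses E tau as the sum of the P (tau > i), and derives the
    measurability of tau from that of the events tau <= i. *)
Lemma time_ereal_series (t : option nat) :
  time_ereal R t = (\sum_(i <oo) ((~~ time_le t i)%:R)%:E)%E.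
Proof.
have sumE i : (\sum_(0 <= j < i) ((~~ time_le t j)%:R : R)%:E)%E =
    (\sum_(0 <= j < i) (~~ time_le t j)%:R)%:E by rewrite sumEFin.
have ge i : ((\sum_(0 <= j < i) (~~ time_le t j)%:R)%:E <=
    \sum_(i <oo) ((~~ time_le t i)%:R : R)%:E)%E.
  by rewrite -sumE; apply: nneseries_lim_ge => k _ _; rewrite lee_fin.
apply/eqP; rewrite eq_le; apply/andP; split.
  case: t sumE ge => [m|] /= _ ge.
    have := ge m; under eq_bigr do rewrite -ltnNge.
    by rewrite sum_ltn_nat minnn.
  rewrite leye_eq; apply/eqP; apply/eqyP => r r0.
  apply: le_trans (ge (Num.truncn r).+1).
  under eq_bigr do rewrite /=; rewrite lee_fin sumr_const_nat subn0.
  by rewrite ltW// truncnS_gt.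
apply: lime_le.
  by apply: is_cvg_nneseries => k _ _; rewrite lee_fin.
by apply: nearW => i; rewrite sumE time_ereal_ge_sum.
Qed.

Lemma measurable_time_ereal d (T : measurableType d) (tau : T -> option nat) :
  (forall i, measurable [set w | time_le (tau w) i]) ->
  measurable_fun setT (fun w => time_ereal R (tau w)).
Proof.
move=> mtau; under eq_fun do rewrite time_ereal_series.
apply: ge0_emeasurable_sum => [k w _ _|k _]; first by rewrite lee_fin.
have mb : measurable_fun setT (fun w => time_le (tau w) k).
  by apply: (measurable_fun_bool true); rewrite setTI; exact: mtau.
apply/measurable_EFinP.
exact: (measurableT_comp (g := fun w => time_le (tau w) k)
  (f := fun b : bool => (~~ b)%:R : R) _ mb).
Qed.
End times.

(** * Lower bound for every policy *)

Section policy_lower_bound.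
Context (d : measure_display) (T : measurableType d) (R : realType)
  (P : probability T R) (X : nat -> {RV P >-> R}) (F : R -> R).
Hypothesis hF : continuous F.
Hypothesis hXF : forall (i : nat) (r : R), cdf (X i) r = (F r)%:E.
Hypothesis hX : independent_seq X.
Local Notation unif := (unif X F).
Variables (n' : nat).
Local Notation n := n'.+1.
Variable (pi : n.-tuple (T -> option nat)).
Hypothesis hpi : selection_policy X pi.

Let rule i w (_ : nat * R) := [exists k : 'I_n, tnth pi k w == Some i.+1].
Local Notation run := (run X F n rule).

Let rule_adapted i : adapted X i (run i) ->
  adapted X i.+1 (fun w => rule i w (run i w)).
Proof.
move=> _; apply/adaptedP; apply: (measurable_fun_bool true).
rewrite setTI.
have -> : (fun w => rule i w (run i w)) @^-1` [set true] =
    \bigcup_(k in [set: 'I_n])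
      ([set w | time_le (tnth pi k w) i.+1] `\` [set w | time_le (tnth pi k w) i]).
  apply/seteqP; split => w /=.
    move=> /existsP[k /eqP kE]; exists k => //=; rewrite kE /=.
    by split; [exact: leqnn|rewrite ltnn].
  move=> [k _ /= [+ +]]; case E : (tnth pi k w) => [m|//] /= h1 /negP h2.
  apply/existsP; exists k; rewrite E; apply/eqP; congr Some.
  by apply/eqP; rewrite eqn_leq h1 ltnNge.
apply: fin_bigcup_measurable; first exact: finite_finset.
move=> k _; apply: measurableD; first exact: (hpi.1 k i.+1).
exact: (@filtrationS _ _ _ _ X i _ (hpi.1 k i)).
Qed.

Section selection_path.
Variables (w : T) (t : 'I_n -> nat).
Hypothesis tE : forall k, tnth pi k w = Some (t k).
Hypothesis t_lt : forall j k : 'I_n, (j < k)%N -> (t j < t k)%N.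
Hypothesis X_lt : forall j k : 'I_n, (j < k)%N -> X (t j).-1 w < X (t k).-1 w.

Let t_inj : injective t.
Proof.
move=> j k; case: (ltngtP j k) => [/t_lt|/t_lt|/val_inj//] => + e;
  by rewrite e ltnn.
Qed.

Lemma run_count i : t ord0 <> 0%N -> (run i w).1 = (\sum_(k < n) (i < t k))%N.
Proof.
move=> t0; elim: i => [|i ih] /=.
  rewrite -[LHS]card_ord -sum1_card; apply: eq_bigr => k _.
  have [->|k0] := eqVneq k ord0; first by have := t0; case: (t ord0).
  have : (t ord0 < t k)%N by apply: t_lt; rewrite lt0n.
  by case: (t k).
have split_i : (\sum_(k < n) (i < t k) =
    \sum_(k < n) (i.+1 < t k) + \sum_(k < n) (t k == i.+1))%N.
  by rewrite -big_split; apply: eq_bigr => k _ /=; lia.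
rewrite /rule; case: ifPn => [/existsP[k]|/existsPn h] /=; rewrite ih split_i.
  rewrite tE => /eqP[tk].
  have -> : (\sum_(j < n) (t j == i.+1) = 1)%N.
    rewrite (bigD1 k)//= tk eqxx big1 ?addn0// => j jk.
    by rewrite -tk (inj_eq t_inj) (negbTE jk).
  by rewrite addn1.
rewrite [X in (_ + X)%N]big1 ?addn0// => k _.
by have := h k; rewrite tE; case: (t k =P i.+1) => // ->; rewrite eqxx.
Qed.

Lemma run_level i : (run i w).2 = 0 \/
  exists2 k : 'I_n, (t k <= i)%N & (run i w).2 = unif (t k).-1 w.
Proof.
elim: i => [|i ih] /=; first by left.
rewrite /rule; case: ifPn => [/existsP[k]|_] /=.
  by rewrite tE => /eqP[tk]; right; exists k; rewrite tk.
by case: ih => [->|[k tk ->]]; [left|right; exists k => //; exact: leqW].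
Qed.

(** The selected observations increase, hence their ranks do so weakly. *)
Lemma rule_level i : rule i w (run i w) -> (run i w).2 <= unif i w.
Proof.
move=> /existsP[k]; rewrite tE => /eqP[tk].
have [->|[j tj ->]] := run_level i; first exact: unif_ge0.
have jk : (j < k)%N.
  rewrite ltnNge; apply/negP; rewrite leq_eqVlt => /predU1P[/val_inj e|/t_lt].
    by move: tj; rewrite -e tk ltnn.
  by rewrite tk; lia.
by apply: (F_homo hXF); have := X_lt jk; rewrite tk => /ltW.
Qed.

Lemma running_lt i : t ord0 <> 0%N -> (0 < (run i w).1)%N -> (i < t ord_max)%N.
Proof.
move=> t0; rewrite run_count// => h.
have [k ik] : exists k, (i < t k)%N.
  apply/existsP; apply: contraLR h => /existsPn h; rewrite -leqNgt leqn0.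
  by rewrite sum_nat_eq0; apply/forallP => k /=; rewrite (negbTE (h k)).
apply: (leq_trans ik).
have [->//|km] := eqVneq k ord_max.
by apply/ltnW/t_lt; rewrite ltn_neqAle km -ltnS ltn_ord.
Qed.

End selection_path.

(** Summing [potential_le_step] up to time i leaves the potential at time i,
    which is at most value n on tau > i and 0 elsewhere, hence at most value n
    * tau / (i + 1). Its mean vanishes as i tends to infinity because tau is
    integrable. *)
Lemma policy_cost_ge : (expected_last_time P pi < +oo)%E ->
  ((value R n)%:E <= expected_last_time P pi)%E.
Proof.
set v := value R n; have v0 : 0 < v := valueS_gt0 R n'.
pose tau w := time_ereal R (last (fun=> None) pi w).
have lastE : last (fun=> None) pi = tnth pi ord_max.
  by rewrite (tnth_nth (fun=> None)) -nth_last size_tuple.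
have mtau : measurable_fun setT tau.
  apply: measurable_time_ereal => i; rewrite lastE.
  exact: filtration_measurable (hpi.1 ord_max i).
have tau0 w : (0 <= tau w)%E.
  by rewrite /tau; case: (last _ _ _) => [m|] /=; rewrite ?lee_fin ?leey.
rewrite /expected_last_time -/tau => taufin.
set e := (\int[P]_w tau w)%E in taufin *.
have e0 : (0 <= e)%E by apply: integral_ge0.
(* Truncating at v, that is c = v^-1, leaves the initial potential equal to v. *)
have c0 : 0 < v^-1 by rewrite invr_gt0.
have cn : v^-1 * value R n <= 1 by rewrite mulVf ?lexx ?gt_eqF.
have rule_above i : {ae P, forall w, rule i w (run i w) -> (run i w).2 <= unif i w}.
  have := hpi.2; apply: filterS => w [t [tE _ tlt Xlt]].
  exact: (rule_level tE tlt Xlt).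
have bound i : (v%:E <= (1 + v / i.+1%:R)%:E * e)%E.
  have := potential_le_sum hF hXF hX rule_adapted c0 cn rule_above i.
  have -> : potential v^-1 n 0 = v.
    by rewrite /potential subr0 mulVf ?gt_eqF// maxxx divr1.
  move=> /le_trans; apply.
  have c1 : 0 <= 1 + v / i.+1%:R by rewrite addr_ge0// divr_ge0// ltW.
  have ms : measurable_fun setT
      (fun w => (\sum_(0 <= j < i) (0 < (run j w).1)%:R : R)%:E).
    apply/measurable_EFinP; apply: measurable_sum => j.
    exact: measurable_running.
  have mp : measurable_fun setT
      (fun w => (potential v^-1 (run i w).1 (run i w).2)%:E).
    by apply/measurable_EFinP; exact: measurable_run_potential.
  have p0 w : (0 <= (potential v^-1 (run i w).1 (run i w).2)%:E)%E.
    by rewrite lee_fin potential_ge0// ltW.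
  have s0 w : (0 <= (\sum_(0 <= j < i) (0 < (run j w).1)%:R : R)%:E)%E.
    by rewrite lee_fin sumr_ge0.
  rewrite -ge0_integralD// -ge0_integralZl_EFin//.
  apply: ae_ge0_le_integral => //.
  - by move=> w _; exact: adde_ge0.
  - exact: emeasurable_funD.
  - by move=> w _; rewrite mule_ge0.
  - exact: measurable_funeM.
  have := hpi.2; apply: filterS => w [t [tE t1 tlt Xlt]] _.
  have t0 : t ord0 <> 0%N by have := t1 ord0; lia.
  rewrite /tau lastE tE /= -EFinM lee_fin.
  have potle := potential_le (run i w).1 (run i w).2 c0.
  have sumle : \sum_(0 <= j < i) (0 < (run j w).1)%:R <= (minn i (t ord_max))%:R :> R.
    rewrite -sum_ltn_nat; apply: ler_sum => j _; rewrite ler_nat.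
    by case: ltnP => // /(running_lt tE tlt t0) ->.
  rewrite invrK in potle.
  apply: (le_trans (lerD sumle potle)).
  rewrite mulrDl mul1r; apply: lerD; first by rewrite ler_nat geq_minr.
  case: ltnP => [h|_]; last by rewrite mulr0 mulr_ge0// divr_ge0// ltW.
  rewrite mulr1 mulrAC ler_pdivlMr// ler_pM2l// ler_nat.
  exact: (running_lt tE tlt t0 h).
move: e0 taufin bound; case: e => [e| |]// e0 _ bound.
rewrite lee_fin; apply/ler_addgt0Pr => eps eps0.
have := bound (Num.truncn (v * e / eps)).
rewrite -EFinM lee_fin mulrDl mul1r => /le_trans; apply.
rewrite lerD2l mulrAC ler_pdivrMr//.
rewrite -ler_pdivrMl// mulrC; apply/ltW/truncnS_gt.
Qed.

End policy_lower_bound.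

(** * The optimal threshold policy *)

Section upper_bound.
Context (d : measure_display) (T : measurableType d) (R : realType)
  (P : probability T R) (X : nat -> {RV P >-> R}) (F : R -> R).
Hypothesis hF : continuous F.
Hypothesis hXF : forall (i : nat) (r : R), cdf (X i) r = (F r)%:E.
Hypothesis hX : independent_seq X.
Local Notation unif := (unif X F).
Variables (n' : nat).
Local Notation n := n'.+1.

Definition accepts (s : nat * R) (u : R) : bool :=
  [&& (0 < s.1)%N, s.2 < u & u <= s.2 + width R s.1 * (1 - s.2)].

Let rule i w (s : nat * R) := accepts s (unif i w).
Local Notation run := (run X F n rule).

Lemma measurable_accepts d' (S : measurableType d') (s : S -> nat * R) (u : S -> R) :
  measurable_fun setT s -> measurable_fun setT u ->
  measurable_fun setT (fun w => accepts (s w) (u w)).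
Proof.
move=> ms mu_.
have m1 : measurable_fun setT (fun w => (s w).1) by exact: measurableT_comp ms.
have m2 : measurable_fun setT (fun w => (s w).2) by exact: measurableT_comp ms.
apply: measurable_and.
  exact: (measurableT_comp (measurable_nat (fun k => 0 < k)%N) m1).
apply: measurable_and; first exact: measurable_fun_ltr.
apply: measurable_fun_ler => //; apply: measurable_funD => //.
apply: measurable_funM.
  exact: (measurableT_comp (measurable_nat (width R)) m1).
exact: measurable_funB.
Qed.

Let rule_adapted i : adapted X i (run i) ->
  adapted X i.+1 (fun w => rule i w (run i w)).
Proof.
move=> /adaptedS/adaptedP ms; have /adaptedP mU := @adapted_unif _ _ _ _ X _ hF i.
by apply/adaptedP; exact: measurable_accepts.
Qed.

(** A window of relative width less than 1 stays away from 1. Only the last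
    selection has width 1, and the level is immaterial after it. *)
Lemma run_bounds i w : 0 <= (run i w).2 /\ ((0 < (run i w).1)%N -> (run i w).2 < 1).
Proof.
split; first exact: (run_ge0 hXF).
elim: i => //= i ih; rewrite /rule; case: ifPn => //= /and3P[k0 _ ub] k1.
have x1 := ih k0; apply: (le_lt_trans ub).
move: (run i w) k0 k1 x1 {ub ih} => [[|[|k]] x]//= _ _ x1.
have := width_lt1 R k; rewrite -subr_gt0 => w1.
have : 0 < (1 - width R k.+2) * (1 - x) by rewrite mulr_gt0// subr_gt0.
lra.
Qed.

Definition threshold_next (s : nat * R) (u : R) : R :=
  let s' := if accepts s u then (s.1.-1, u) else s in potential 0 s'.1 s'.2.

Lemma measurable_threshold_next :
  measurable_fun setT (fun z : (nat * R) * R => threshold_next z.1 z.2).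
Proof.
rewrite /threshold_next.
pose s' (z : (nat * R) * R) := if accepts z.1 z.2 then (z.1.1.-1, z.2) else z.1.
have ms' : measurable_fun setT s'.
  apply: measurable_fun_ifT => //; first exact: measurable_accepts.
  apply: measurable_fun_pair => //.
  apply: (measurableT_comp (measurable_nat predn)).
  exact: (measurableT_comp measurable_fst measurable_fst).
apply: (measurable_potential 0 (k := fun z => (s' z).1) (x := fun z => (s' z).2)).
  exact: (measurableT_comp measurable_fst ms').
exact: (measurableT_comp measurable_snd ms').
Qed.

(** Under the optimal rule the untruncated potential solves the Bellman
    equation exactly. *)
Lemma threshold_next_mean k x : 0 <= x -> ((0 < k)%N -> x < 1) ->
  ((0 < k)%:R%:E +
    \int[lebesgue_measure]_(u in `[0%R, 1%R]) (threshold_next (k, x) u)%:E =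
   (potential 0 k x)%:E)%E.
Proof.
move=> x0; case: k => [_|k /(_ isT) x1].
  rewrite potential0 add0e; apply: integral0_eq => u _.
  by rewrite /threshold_next /accepts /= potential0.
have r01 : 0 < 1 - x <= 1 by apply/andP; split; lra.
have potE m u : u <= 1 -> potential 0 m u = value R m / (1 - u).
  by move=> u1; rewrite /potential mul0r max_l// subr_ge0.
rewrite (potE _ _ (ltW x1)) -(integral_threshold_cost false k r01).
congr (_ + _)%E; apply: eq_integral => u; rewrite inE/= in_itv/= => /andP[u0 u1].
rewrite /threshold_next /accepts /threshold_cost /= in_itv/= subKr.
by congr EFin; case: ifP => _ /=; rewrite potE// ltW.
Qed.

Lemma potential_threshold_step i :
  (\int[P]_w (potential 0 (run i w).1 (run i w).2)%:E =
   \int[P]_w ((0 < (run i w).1)%:R)%:E +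
   \int[P]_w (potential 0 (run i.+1 w).1 (run i.+1 w).2)%:E)%E.
Proof.
have p0 k x : 0 <= potential 0 k x :> R by exact: potential_ge0.
have g0 s u : 0 <= threshold_next s u by exact: p0.
have mg := measurable_threshold_next.
have -> : (\int[P]_w (potential 0 (run i.+1 w).1 (run i.+1 w).2)%:E =
    \int[P]_w (threshold_next (run i w) (unif i w))%:E)%E by [].
rewrite (integral_fresh_unif hF hXF hX rule_adapted)// -ge0_integralD//.
- apply: eq_integral => w _; have := run_bounds i w.
  by case: (run i w) => k x [x0 x1]; rewrite threshold_next_mean.
- by apply/measurable_EFinP; exact: measurable_running.
- by move=> w _; apply: integral_ge0 => u _; rewrite lee_fin.
- exact: (measurableT_comp (measurable_integral_unit hF hXF mg g0)
    (measurable_run hF rule_adapted i)).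
Qed.

(** Elapsed time plus potential has constant mean, and the potential left over
    is nonnegative. *)
Lemma sum_running_le i :
  (\sum_(0 <= j < i) \int[P]_w ((0 < (run j w).1)%:R)%:E <= (value R n)%:E)%E.
Proof.
have p0 k x : 0 <= potential 0 k x :> R by exact: potential_ge0.
suff <- : (\sum_(0 <= j < i) \int[P]_w ((0 < (run j w).1)%:R)%:E +
    \int[P]_w (potential 0 (run i w).1 (run i w).2)%:E = (value R n)%:E)%E.
  by rewrite leeDl// integral_ge0// => w _; rewrite lee_fin.
elim: i => [|i <-].
  rewrite big_geq// add0e /=.
  have := integral_cst P measurableT (potential 0 n 0)%:E.
  rewrite /cst => ->; rewrite [X in (_ * X)%E](@probability_setT _ _ _ P) mule1.
  by rewrite /potential subr0 mul0r max_l// divr1.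
rewrite big_nat_recr//= -[LHS]addeA; congr (_ + _)%E.
exact: esym (potential_threshold_step i).
Qed.

Definition hit m w : option nat :=
  match pselect (exists i, ((run i w).1 <= m)%N) with
  | left h => Some (ex_minn h)
  | right _ => None
  end.

Lemma run_nonincr i j w : (i <= j)%N -> ((run j w).1 <= (run i w).1)%N.
Proof.
move=> ij; rewrite -(subnKC ij); elim: (j - i)%N => [|k ih]; first by rewrite addn0.
by rewrite addnS /=; case: ifP => _ //=; apply: leq_trans ih; exact: leq_pred.
Qed.

Lemma run_level_nondecr i j w : (i <= j)%N -> (run i w).2 <= (run j w).2.
Proof.
move=> ij; rewrite -(subnKC ij); elim: (j - i)%N => [|k ih]; first by rewrite addn0.
rewrite addnS /=; apply: (le_trans ih); rewrite /rule; case: ifP => //=.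
by move=> /and3P[_ /ltW].
Qed.

Lemma time_le_hit m w i : time_le (hit m w) i = ((run i w).1 <= m)%N.
Proof.
rewrite /hit; case: pselect => [h|h] /=.
  case: ex_minnP => j jm jmin; apply/idP/idP; last exact: jmin.
  by move=> ji; apply: leq_trans jm; exact: run_nonincr.
by symmetry; apply/negP => im; apply: h; exists i.
Qed.

Lemma hit_stopping m : stopping_time (natural_filtration X) (hit m).
Proof.
move=> i; have -> : [set w | time_le (hit m w) i] = run i @^-1` [set s | (s.1 <= m)%N].
  by apply/seteqP; split => w /=; rewrite time_le_hit.
apply: (@adapted_run _ _ _ _ X F hF n rule rule_adapted i).
rewrite -[X in measurable X]setTI.
have mfst : measurable_fun [set: nat * R] fst := measurable_fst.
exact: (mfst measurableT [set k | (k <= m)%N]).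
Qed.

(** Component k, which stands for tau_(k+1), is the first time when n - (k +
    1) selections remain. *)
Definition threshold_policy : n.-tuple (T -> option nat) :=
  [tuple hit (n' - k)%N | k < n].

Lemma last_threshold_policy : last (fun=> None) threshold_policy = hit 0.
Proof.
have -> : last (fun=> None) threshold_policy = tnth threshold_policy ord_max.
  by rewrite (tnth_nth (fun=> None)) -nth_last size_tuple.
by rewrite tnth_mktuple /= subnn.
Qed.

Lemma threshold_policy_cost_le :
  (expected_last_time P threshold_policy <= (value R n)%:E)%E.
Proof.
rewrite /expected_last_time last_threshold_policy.
under eq_integral do rewrite time_ereal_series.
rewrite integral_nneseries//.
- apply: lime_le.
    apply: is_cvg_nneseries => k _ _; apply: integral_ge0 => w _.
    by rewrite lee_fin.
  apply: nearW => i; apply: le_trans (sum_running_le i).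
  rewrite le_eqVlt; apply/orP; left; apply/eqP; apply: eq_bigr => j _.
  by apply: eq_integral => w _; rewrite time_le_hit -ltnNge.
- move=> k; have -> : (fun w => ((~~ time_le (hit 0 w) k)%:R : R)%:E) =
      (fun w => ((0 < (run k w).1)%:R)%:E).
    by apply/funext => w; rewrite time_le_hit -ltnNge.
  by apply/measurable_EFinP; exact: measurable_running.
Qed.

(** The count drops by one at a time, so it equals m when it first is at most
    m, and the observation met at that instant has just been selected. *)
Lemma hit_spec m w t : (m < n)%N -> hit m w = Some t ->
  [/\ (0 < t)%N, (run t w).1 = m, (run t w).2 = unif t.-1 w,
      (run t.-1 w).2 < unif t.-1 w & (m < (run t.-1 w).1)%N].
Proof.
move=> mn hE.
have tm : ((run t w).1 <= m)%N by rewrite -time_le_hit hE /=.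
have t0 : (0 < t)%N by case: t tm {hE} => //=; lia.
have pm : (m < (run t.-1 w).1)%N.
  by rewrite ltnNge -time_le_hit hE /=; lia.
case: t t0 tm pm {hE} => //= t _; rewrite /rule; case: ifPn => [/and3P[_ xu _]|_] /=.
  by split => //; lia.
by move=> h1; rewrite ltnNge h1.
Qed.

(** The last time has finite mean, so it is almost surely finite; all earlier
    times then are finite too. *)
Lemma threshold_policy_selects : Pi_ X n threshold_policy.
Proof.
have cost := threshold_policy_cost_le.
have fin : (expected_last_time P threshold_policy < +oo)%E.
  by apply: (le_lt_trans cost); rewrite ltry.
split=> //; split.
  by move=> k; rewrite tnth_mktuple; exact: hit_stopping.
pose tau w := time_ereal R (hit 0 w).
have tau0 w : (0 <= tau w)%E.
  by rewrite /tau; case: (hit _ _) => [m|] /=; rewrite ?lee_fin ?leey.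
have itau : P.-integrable setT tau.
  apply/integrableP; split.
    apply: measurable_time_ereal => i; exact: filtration_measurable (@hit_stopping 0 i).
  under eq_integral do rewrite gee0_abs//.
  by move: fin; rewrite /expected_last_time last_threshold_policy.
have := integrable_ae measurableT itau; apply: filterS => w /(_ I).
rewrite /tau; case h0 : (hit 0 w) => [t0|//] _.
have hit_some m : exists t, hit m w = Some t.
  have : time_le (hit m w) t0.
    rewrite time_le_hit; apply: (@leq_trans 0) => //.
    by rewrite -time_le_hit h0 /=.
  by case: (hit m w) => // t _; exists t.
pose t (k : 'I_n) := projT1 (cid (hit_some (n' - k)%N)).
have tE (k : 'I_n) : hit (n' - k)%N w = Some (t k) :=
  projT2 (cid (hit_some (n' - k)%N)).
have mn (k : 'I_n) : (n' - k < n)%N by rewrite ltnS leq_subr.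
have t_lt (j k : 'I_n) : (j < k)%N -> (t j < t k)%N.
  move=> jk.
  have [_ ej _ _ _] := hit_spec (mn j) (tE j).
  have [_ ek _ _ _] := hit_spec (mn k) (tE k).
  rewrite ltnNge; apply/negP => /(run_nonincr w); rewrite ej ek.
  by have := ltn_ord k; lia.
exists t; split => //.
- by move=> k; rewrite tnth_mktuple.
- by move=> k; have [] := hit_spec (mn k) (tE k).
- move=> j k jk; have tjk := t_lt j k jk.
  have [_ _ ej _ _] := hit_spec (mn j) (tE j).
  have [k0 _ _ xk _] := hit_spec (mn k) (tE k).
  apply: (F_lt hXF); rewrite -[F (X (t j).-1 w)]/(unif (t j).-1 w) -ej.
  apply: le_lt_trans xk; apply: run_level_nondecr; lia.
Qed.

End upper_bound.

(** * The value of beta *)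

Section value_of_beta.
Context (d : measure_display) (T : measurableType d) (R : realType)
  (P : probability T R) (X : nat -> {RV P >-> R}) (F : R -> R).
Hypothesis hF : continuous F.
Hypothesis hXF : forall (i : nat) (r : R), cdf (X i) r = (F r)%:E.
Hypothesis hX : independent_seq X.

Lemma threshold_policy_optimal n' :
  expected_last_time P (threshold_policy X F n') = (value R n'.+1)%:E.
Proof.
apply/eqP; rewrite eq_le threshold_policy_cost_le//=.
have [sel fin] := threshold_policy_selects hF hXF hX n'.
exact: policy_cost_ge.
Qed.

Lemma beta_value n' : beta X n'.+1 = (value R n'.+1)%:E.
Proof.
apply/eqP; rewrite eq_le; apply/andP; split.
  rewrite -threshold_policy_optimal; apply: ereal_inf_lbound.
  by exists (threshold_policy X F n') => //; exact: threshold_policy_selects.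
apply/ereal_infP => _ [pi [sel fin] <-]; exact: policy_cost_ge.
Qed.

End value_of_beta.

Theorem theorem1 (d : measure_display) (T : measurableType d) (R : realType)
    (P : probability T R) (X : nat -> {RV P >-> R}) (F : R -> R)
    (hF : continuous F)
    (hXF : forall (i : nat) (r : R), cdf (X i) r = (F r)%:E)
    (hX : independent_seq X) :
  [/\ (* beta n is a minimum *)
      forall n : nat, (1 <= n)%N ->
        exists2 pi, Pi_ X n pi & expected_last_time P pi = beta X n,
      (* convexity *)
      forall m n : nat, (1 <= m)%N -> (m <= n)%N ->
        (beta X m.+1 - beta X m <= beta X n.+1 - beta X n)%E,
      beta X 1 = 1%E
    & forall n : nat, (2 <= n)%N ->
        ((2^-1 * n%:R ^+ 2)%:E <= beta X n)%E /\
        (beta X n <= (2^-1 * n%:R ^+ 2 + n%:R * ln n%:R)%:E)%E].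
Proof.
have bE := beta_value hF hXF hX.
split.
- case=> [//|n] _; exists (threshold_policy X F n); first exact: threshold_policy_selects.
  by rewrite bE; exact: threshold_policy_optimal.
- case=> [//|m] [|n] // _ mn.
  by rewrite !bE -!EFinB lee_fin; exact: value_convex.
- by rewrite bE value1.
- case=> [//|n] n2; rewrite bE !lee_fin.
  by split; [exact: value_ge_half_sq|exact: value_le_sq_ln].
Qed.
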